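(* Let $(E,C)$ be a separated graph without isolated vertices. Let $\mathfrak T'$ be the set of all non-trivial lower subsets $Z'$ of $\mathbb F_C(v)$ such that $Z'_g$ is a finite-maximal local configuration for all $g\in Z'$, where $v$ ranges over all vertices of $E$. Then there is a bijection $$\mathfrak T'\cup E^{0,r}_\infty\cong\mathfrak T$$ between $\mathfrak T'\cup E^{0,r}_\infty$ and the space $\mathfrak T$ of tight filters.
   Context: A directed graph $E=(E^0,E^1,s,r)$ consists of sets $E^0$, $E^1$ (arbitrary cardinality) and maps $s,r\colon E^1\to E^0$. A separated graph $(E,C)$ is a directed graph with $C=\bigsqcup_{v}C_v$, where $C_v$ is a partition of $s^{-1}(v)$ into pairwise disjoint nonempty subsets ($C_v=\emptyset$ if $s^{-1}(v)=\emptyset$). A vertex $v$ is isolated if $s^{-1}(v)=r^{-1}(v)=\emptyset$. $C^{\mathrm{fin}}_v=\{X\in C_v:|X|<\infty\}$. $E^{-1}=\{e^{-1}:e\in E^1\}$ is a set of formal inverses, $\hat E^1=E^1\sqcup E^{-1}$, $s(e^{-1})=r(e)$, $r(e^{-1})=s(e)$, $(e^{-1})^{-1}=e$. A path is a vertex or a word $y_1\cdots y_n$ with $y_i\in\hat E^1$, $r(y_i)=s(y_{i+1})$; it is reduced if it contains no subword $xx^{-1}$, $x\in\hat E^1$; $\mathrm{red}(\gamma)$ is the reduction of $\gamma$ via $xx^{-1}\to s(x)$, and $g\cdot h=\mathrm{red}(gh)$ when $r(g)=s(h)$. $\mathbb F_C$ is the set of $C$-separated paths: reduced paths (vertices included)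 with no subword $x^{-1}y$ with $x,y\in X$, $X\in C$; $\mathbb F_C(v)=\{w\in\mathbb F_C:s(w)=v\}$. The prefix order $\mu\le_p\nu$ means that $\mu$ is an initial segment of $\nu$; lower subsets are with respect to $\le_p$; a lower subset $Z$ of $\mathbb F_C(v)$ is non-trivial if $|Z|\ge2$. Vertices count as not ending in $E^{-1}$. $\gamma,\nu\in\mathbb F_C(v)\setminus\{v\}$ are $C$-compatible if $\mathrm{red}(\nu^{-1}\gamma)\in\mathbb F_C$; $v$ is $C$-compatible with all elements of $\mathbb F_C(v)$; a subset of $\mathbb F_C(v)$ is $C$-compatible if its elements are pairwise $C$-compatible. A local configuration at $v\in E^0$ is a nonempty subset $\mathfrak c\subseteq\{x\in\hat E^1:s(x)=v\}$; it is admissible if it is $C$-compatible (equivalently, contains no two distinct edges from the same $X\in C_v$). It is finite-maximal if it is admissible and for each $X\in C^{\mathrm{fin}}_v$ there is $z_X\in X$ such that $\{z_X:X\in C^{\mathrm{fin}}_v\}\cup\{x^{-1}:x\in r^{-1}(v)\}\subseteq\mathfrak c$. For a non-trivial lower subset $Z$ of $\mathbb F_C(v)$ and $g\in Z$, $Z_g=\{x\in\hat E^1:s(x)=r(g),\ g\cdot x\in Z\}$, a local configuration at $r(g)$. $E^{0,r}_\infty=\{v\in E^0:r^{-1}(v)=\emptyset\text{ and }|X|=\infty\text{ for all }X\in C_v\}$. $\mathfrak F(v)$ is the set of all (possibly infinite) nonempty $C$-compatible lower subsets $Z$ of $\mathbb F_C(v)$ such that each $z\in Z$ is a prefix of an element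 of $Z$ not ending in $E^{-1}$; $\mathfrak F=\bigsqcup_v\mathfrak F(v)$, ordered by inclusion, and $\mathfrak U$ is the set of its maximal elements. Let $\mathcal X_0$ be the set of nonempty finite $C$-compatible lower subsets of some $\mathbb F_C(v)$, $v\in E^0$, none of whose maximal elements ends in $E^{-1}$. The topology of $\mathfrak F$ has as basis the sets $\{Z\in\mathfrak F: I\subseteq Z,\ J\not\subseteq Z\ \forall J\in G\}$ with $I\in\mathcal X_0$, $G\subseteq\mathcal X_0$ finite. $\mathfrak T$ is the closure of $\mathfrak U$ in $\mathfrak F$. ($\mathfrak F$, $\mathfrak U$, $\mathfrak T$ are identified with the space of filters, the ultrafilters, and the tight filters on the semilattice of idempotents of the inverse semigroup of $(E,C)$.) *)

(* Defs.v *)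
From HB Require Import structures.
From mathcomp Require Import all_boot.
From mathcomp Require Import boolp classical_sets cardinality topology.

Set Implicit Arguments.
Unset Strict Implicit.
Unset Printing Implicit Defensive.

Local Open Scope classical_set_scope.

(* Vertices and edges are arbitrary sets: classically every type is a
   choiceType, and no finiteness or countability is assumed. *)
Record separated_graph := SeparatedGraph {
  vertex : choiceType;
  edge : choiceType;
  src : edge -> vertex;
  rng : edge -> vertex;
  sep : vertex -> set (set edge);
  sepP : forall v, partition (sep v) id (src @^-1` [set v])
}.

Arguments src {_} _.
Arguments rng {_} _.

Section Paths.
Variable E : separated_graph.
Implicit Types (v : vertex E) (X : set (edge E)).

Definition isolated_vertex v := src @^-1` [set v] = set0 /\ rng @^-1` [set v] = set0.

Definition sep_fin v : set (set (edge E)) :=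
  [set X | sep v X /\ finite_set X].

(* The double edge set: [inl e] is the edge e, [inr e] its formal inverse. *)
Definition dedge : choiceType := (edge E + edge E)%type.
Definition dsrc (x : dedge) : vertex E :=
  match x with inl e => src e | inr e => rng e end.
Definition drng (x : dedge) : vertex E :=
  match x with inl e => rng e | inr e => src e end.
Definition dinv (x : dedge) : dedge :=
  match x with inl e => inr e | inr e => inl e end.

(* A word is its source together with its letters, so that (v, [::]) is the
   vertex v seen as a path of length zero. *)
Definition word : choiceType := (vertex E * seq dedge)%type.
Definition vpath v : word := (v, [::]).
Definition letter (x : dedge) : word := (dsrc x, [:: x]).

Fixpoint walk v (s : seq dedge) : bool :=
  if s is x :: s' then (dsrc x == v) && walk (drng x) s' else true.
Definition is_path (w : word) : bool := walk w.1 w.2.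

Definition psrc (w : word) : vertex E := w.1.
Definition prng (w : word) : vertex E := last w.1 (map drng w.2).

Definition pinv (w : word) : word := (prng w, rev (map dinv w.2)).
Definition pcat (w1 w2 : word) : word := (psrc w1, w1.2 ++ w2.2).

Definition reduced (w : word) : Prop :=
  forall x : dedge, ~~ infix [:: x; dinv x] w.2.

(* Reduction x x^-1 ~> s(x), processing the letters from right to left: the
   letter x is put in front of an already reduced word s. *)
Definition red_cons (x : dedge) (s : seq dedge) : seq dedge :=
  if s is y :: s' then if y == dinv x then s' else x :: s else [:: x].
Definition red (w : word) : word := (w.1, foldr red_cons [::] w.2).

Definition pdot (g h : word) : word := red (pcat g h).

Definition C_separated (w : word) : Prop :=
  [/\ is_path w, reduced w &
      forall v X x y, sep v X -> X x -> X y ->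
        ~~ infix [:: inr x : dedge; inl y] w.2].

Definition FC v : set word := [set w | C_separated w /\ psrc w = v].

Definition prefix_le (m n : word) : Prop := psrc m = psrc n /\ prefix m.2 n.2.

Definition lower_subset v (Z : set word) : Prop :=
  Z `<=` FC v /\
  forall m n, FC v m -> prefix_le m n -> Z n -> Z m.

Definition nontrivial (Z : set word) : Prop :=
  exists z1 z2, [/\ Z z1, Z z2 & z1 <> z2].

Definition ends_in_inverse (w : word) : Prop :=
  exists s e, w.2 = rcons s (inr e).

Definition C_compatible v (g n : word) : Prop :=
  [\/ g = vpath v, n = vpath v | C_separated (red (pcat (pinv n) g))].

Definition C_compatible_set v (Z : set word) : Prop :=
  Z `<=` FC v /\ forall g n, Z g -> Z n -> C_compatible v g n.

Definition local_configuration v (c : set dedge) : Prop :=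
  c !=set0 /\ c `<=` dsrc @^-1` [set v].

Definition admissible v (c : set dedge) : Prop :=
  local_configuration v c /\ C_compatible_set v (letter @` c).

Definition finite_maximal v (c : set dedge) : Prop :=
  [/\ admissible v c,
      forall X, sep_fin v X -> exists2 z, X z & c (inl z) &
      forall x, rng x = v -> c (inr x)].

Definition local_conf (Z : set word) (g : word) : set dedge :=
  [set x | dsrc x = prng g /\ Z (pdot g (letter x))].

Definition E0r_inf : set (vertex E) :=
  [set v | rng @^-1` [set v] = set0 /\
           forall X, sep v X -> infinite_set X].

Definition frakF_at v : set (set word) :=
  [set Z | [/\ Z !=set0, lower_subset v Z, C_compatible_set v Z &
    forall z, Z z ->
      exists z', [/\ Z z', prefix_le z z' & ~ ends_in_inverse z']]].

(* Since a member of [FC v] determines v and the members of [frakF_at v] are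
   nonempty, this union over v is disjoint. *)
Definition frakF_set : set (set word) :=
  [set Z | exists v, frakF_at v Z].

Definition maximal_in (Z : set word) (z : word) : Prop :=
  Z z /\ forall z', Z z' -> prefix_le z z' -> z' = z.

Definition X0 : set (set word) :=
  [set I | (exists v,
      [/\ I !=set0, finite_set I, lower_subset v I & C_compatible_set v I]) /\
    forall z, maximal_in I z -> ~ ends_in_inverse z].

Definition frakF : Type := set_type frakF_set.
HB.instance Definition _ := Choice.on frakF.

Definition basic_index : pointedType := (set word * set (set word))%type.

Definition basic_dom : set basic_index :=
  [set IG | [/\ X0 IG.1, finite_set IG.2 & IG.2 `<=` X0]].

Definition basic_open (IG : basic_index) : set frakF :=
  [set Z | IG.1 `<=` \val Z /\ forall J, IG.2 J -> ~ (J `<=` \val Z)].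

Lemma X0_vpath v : X0 [set vpath v].
Proof.
have Fv : FC v (vpath v) by split.
split; last by move=> z [-> _] [[|? ?] [e]].
exists v; split.
- by exists (vpath v).
- exact: finite_set1.
- split=> [_ -> //|[m1 m] n /= _ [e p] nv].
  by move: nv e p => -> /= ->; rewrite -/(prefix m [::]) prefixs0 => /eqP ->.
- by split=> [_ -> //|g n -> _]; apply: Or31.
Qed.

Lemma basic_cover : \bigcup_(IG in basic_dom) basic_open IG = setT.
Proof.
apply/seteqP; split=> // Z _.
have /set_mem[v [[z Zz] [ZF Zl] _ _]] := valP Z.
exists ([set vpath v], set0); first by split=> //=; exact: X0_vpath.
split=> //= _ ->; apply: (Zl _ z) => //.
by have [_ <-] := ZF _ Zz; split; rewrite ?prefix0s.
Qed.

Lemma basic_join i j Z : basic_dom i -> basic_dom j ->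
  basic_open i Z -> basic_open j Z ->
  exists k, [/\ basic_dom k, basic_open k Z &
                basic_open k `<=` basic_open i `&` basic_open j].
Proof.
case: i j => [I G] [J H] [/= XI finG GX] [/= XJ finH HX] [/= IZ GZ] [/= JZ HZ].
have /set_mem[v [_ [ZF _] [_ Zc] _]] := valP Z.
have srcv (K : set word) u : K !=set0 -> lower_subset u K -> K `<=` \val Z ->
    u = v.
  by move=> [z Kz] [KF _] KZ; have [_ <-] := KF _ Kz; have [_ <-] := ZF _ (KZ _ Kz).
case: XI XJ => [[u [I0 finI Il _]] Imax] [[u' [J0 finJ Jl _]] Jmax].
have eu := srcv _ _ I0 Il IZ; have eu' := srcv _ _ J0 Jl JZ; subst u u'.
have IJZ : I `|` J `<=` \val Z by move=> z [/IZ|/JZ].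
exists (I `|` J, G `|` H); split=> /=.
- split=> /=; last 2 first.
  + by rewrite finite_setU.
  + by move=> K [/GX|/HX].
  split.
    exists v; split.
    * by case: I0 => z Iz; exists z; left.
    * by rewrite finite_setU.
    * split=> [z /IJZ /ZF //|m n Fm mn [In|Jn]].
        by left; apply: (Il.2 _ n).
      by right; apply: (Jl.2 _ n).
    * by split=> [z /IJZ /ZF //|g n /IJZ Zg /IJZ]; apply: Zc.
  move=> z [[Iz|Jz] zmax].
    by apply: Imax; split=> // z' Iz'; apply: zmax; left.
  by apply: Jmax; split=> // z' Jz'; apply: zmax; right.
- by split=> // K [/GZ|/HZ].
- move=> Y [/= IJY GHY]; split; split=> /= K.
  + by move=> IK; apply: IJY; left.
  + by move=> GK; apply: GHY; left.
  + by move=> JK; apply: IJY; right.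
  + by move=> HK; apply: GHY; right.
Qed.

HB.instance Definition _ :=
  isBaseTopological.Build frakF basic_cover basic_join.

Definition frakU : set frakF :=
  [set Z | forall Z' : frakF, \val Z `<=` \val Z' -> Z' = Z].

Definition frakT : set frakF := closure frakU.

Definition frakT' : set (set word) :=
  [set Z' | exists v, [/\ lower_subset v Z', nontrivial Z' &
    forall g, Z' g -> finite_maximal (prng g) (local_conf Z' g)]].

End Paths.

Arguments E0r_inf E : clear implicits.
Arguments frakU E : clear implicits.
Arguments frakT E : clear implicits.
Arguments frakT' E : clear implicits.

(* Main.v *)
Require Import Defs.
From mathcomp Require Import all_boot zify.
From mathcomp Require Import boolp classical_sets cardinality topology.
From mathcomp Require functions.

Set Implicit Arguments.
Unset Strict Implicit.
Unset Printing Implicit Defensive.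

Local Open Scope classical_set_scope.

(** Fix [v]. A nonempty compatible lower subset of the separated paths from [v]
is a tree: it contains [v], is closed under prefixes, and at no node branches
along two distinct edges of one part ([tree], [treeP]). In this language the
conditions defining [frakT'] say that the tree is saturated: at each node it
contains every incoming edge travelled backwards, and it meets every finite
part. Nontriviality only serves to make local configurations nonempty; the
trivial tree at [v] is saturated exactly when [v] lies in [E0r_inf]. So the
left-hand side of the bijection is the set of all saturated trees
([frakT'P], [E0r_infP]).

The bijection trims a saturated tree [S], keeping the nodes that are prefixes
of nodes of [S] not ending in an inverse edge. Nothing is lost: by saturation
[S] is recovered from [trim S] by appending all possible tails of inverse edges
([grow_trim], [trim_grow]). It remains to see which sets [trim S] are.

- If [Z] is tight then [grow v Z] is saturated ([grow_saturated]). Suppose it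
  misses a finite part [X] at the node [g]. Containing the part of [g] before
  its tail of inverse edges and avoiding the finitely many paths [g x] with [x]
  in [X] is an open condition satisfied by [Z], hence by some ultrafilter [Y].
  But then a path [g x] can be grafted onto [Y] ([graft]), against maximality.

- If [S] is saturated then [trim S] is a limit of ultrafilters ([trim_frakT]).
  A basic neighbourhood asks to avoid a finite set [B] of paths outside [S].
  By Zorn's lemma there is [Y], maximal among the trimmed trees that contain
  [trim S] and avoid [B] ([maximal_avoiding]). It is even an ultrafilter
  ([avoiding_maximal]): a larger [Y'] would contain a path of [B], which leaves
  [S] along an edge [x] at some node [h]. No other edge of the part [X] of [x]
  can be used by [S] at [h], so [X] is infinite by saturation, and some [z] in
  [X] gives a path [h z] outside the finite set [B]. Grafting [h z] onto [Y]
  contradicts the choice of [Y]. *)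

Section TightFilters.
Variable E : separated_graph.
Implicit Types (v : vertex E) (w : word E) (s t u h : seq (dedge E)).
Implicit Types (a b : dedge E) (Z Y : set (word E)).

(** * Consecutive letters of a path *)

Definition same_part (x y : edge E) : Prop :=
  exists v X, [/\ sep v X, X x & X y].

Lemma part_src v X (x : edge E) : sep v X -> X x -> src x = v.
Proof.
move=> vX Xx; have [cov _ _] := sepP v.
have : (src @^-1` [set v]) x by rewrite -cov; exists X.
by [].
Qed.

Lemma same_part_in v X (x y : edge E) :
  sep v X -> X x -> same_part x y -> X y.
Proof.
move=> vX Xx [v' [X' [vX' X'x X'y]]].
have e : v' = v by rewrite -(part_src vX Xx) (part_src vX' X'x).
rewrite {}e in vX'; have [_ triv _] := sepP v.
by rewrite (triv X X' vX vX') //; exists x.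
Qed.

Lemma same_part_sym (x y : edge E) : same_part x y -> same_part y x.
Proof. by move=> [v [X [vX Xx Xy]]]; exists v, X. Qed.

(** The subwords [x^-1 y], with [x] and [y] in one part, that separated paths
avoid. *)
Definition turn a b : Prop :=
  exists x y, [/\ a = inr x, b = inl y & same_part x y].

Definition nobacktrack a b : bool := b != dinv a.

Definition step a b : bool := nobacktrack a b && `[< ~ turn a b >].

Lemma dinvK : involutive (@dinv E).
Proof. by case. Qed.

Lemma dsrc_dinv a : dsrc (dinv a) = drng a. Proof. by case: a. Qed.

Lemma drng_dinv a : drng (dinv a) = dsrc a. Proof. by case: a. Qed.

Lemma nobacktrack_dinv a b :
  nobacktrack (dinv b) (dinv a) = nobacktrack a b.
Proof.
by rewrite /nobacktrack dinvK; apply/idP/idP; apply: contra => /eqP ->;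
  rewrite ?dinvK.
Qed.

(** The inverse of a separated path is separated: forbidden turns are symmetric
because lying in one part is. *)
Lemma step_dinv a b : step (dinv b) (dinv a) = step a b.
Proof.
rewrite /step nobacktrack_dinv; congr (_ && _); apply/asboolP/asboolP.
  by apply: contra_not => -[x [y [-> -> /same_part_sym xy]]]; exists y, x.
apply: contra_not => -[x [y []]]; case: a b => [e|e] [e'|e'] //= -[<-] [<-].
by move=> /same_part_sym xy; exists e, e'.
Qed.

Lemma sorted_catP (e : rel (dedge E)) s t :
  sorted e (s ++ t) <->
  [/\ sorted e s, sorted e t &
      forall s' a t' b, s = rcons s' a -> t = b :: t' -> e a b].
Proof.
case: s => [|x s] /=; first by split=> [?|[]//]; split=> // -[].
rewrite cat_path; case: t => [|b t] /=.
  by rewrite andbT; split=> [?|[]//]; split=> // ? ? [].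
split=> [/and3P[xs eb bt]|[-> -> eb]].
  by split=> // s' a t' b' /(congr1 (last x)); rewrite last_rcons /= => <- [<-].
by rewrite andbT; apply: (eb (belast x s) _ t) => //; rewrite -lastI.
Qed.

Lemma sorted_infixP (e : rel (dedge E)) s :
  sorted e s <-> forall a b, infix [:: a; b] s -> e a b.
Proof.
split=> [es a b /infixP[p [q def_s]]|].
  by move: es; rewrite def_s => /sorted_catP[_ /= /andP[]].
elim: s => [//|x s IHs] es; rewrite -cat1s; apply/sorted_catP; split=> //.
  by apply: IHs => a b ab; apply: es; rewrite infix_consl // ab orbT.
move=> [|c [|d s']] a t b //= [<-] def_s; rewrite def_s in es; apply: es.
by apply: prefixW; rewrite /= !eqxx prefix0s.
Qed.

Lemma walk_cat v s t :
  walk v (s ++ t) = walk v s && walk (last v (map (@drng E) s)) t.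
Proof. by elim: s v => [//|x s IHs] v /=; rewrite IHs andbA. Qed.

Lemma C_separatedP v s : C_separated (v, s) <-> walk v s /\ sorted step s.
Proof.
rewrite /C_separated /is_path /reduced /=; split=> [[ws rs Cs]|[ws /sorted_infixP es]].
  split=> //; apply/sorted_infixP => a b ab; apply/andP; split.
    by apply: contraL ab => /eqP ->; exact: rs.
  apply/asboolP => -[x [y [ea eb [v' [X [vX Xx Xy]]]]]].
  by have := Cs _ _ _ _ vX Xx Xy; rewrite -ea -eb ab.
split=> // [x|v' X x y vX Xx Xy]; apply/negP => /es /andP[].
  by rewrite /nobacktrack eqxx.
by move=> _ /asboolP; apply; exists x, y; split=> //; exists v', X.
Qed.

Lemma FCP v w : FC v w <-> [/\ w.1 = v, walk v w.2 & sorted step w.2].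
Proof.
case: w => v' s; split=> [[/C_separatedP[ws es] /= e]|[/= -> ws es]].
  by rewrite -e.
by split=> //; apply/C_separatedP.
Qed.

(** Separation is a local condition, so a concatenation only has to be checked
at the junction. *)
Lemma FC_catP v s t :
  FC v (v, s ++ t) <->
  [/\ FC v (v, s), walk (prng (v, s)) t, sorted step t &
      forall s' a t' b, s = rcons s' a -> t = b :: t' -> step a b].
Proof.
split=> [/FCP[_ /=]|[/FCP[_ /= ws es] wt et st]].
  rewrite walk_cat => /andP[ws wt] /sorted_catP[es et st].
  by split=> //; apply/FCP.
by apply/FCP; split=> //=; [rewrite walk_cat ws | apply/sorted_catP].
Qed.

Lemma FC_rconsP v s (x : dedge E) :
  FC v (v, rcons s x) <->
  [/\ FC v (v, s), dsrc x = prng (v, s) &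
      forall s' a, s = rcons s' a -> step a x].
Proof.
rewrite -cats1; split=> [/FC_catP[Fs /=]|[Fs ex st]].
  by rewrite andbT => /eqP ex _ st; split=> // s' a e; apply: (st s' a [::]).
by apply/FC_catP; split=> //= [|s' a t' b /st ? [<-]//]; rewrite ex eqxx.
Qed.

Lemma FC_vpath v : FC v (vpath v).
Proof. by apply/FCP. Qed.

Lemma FC_prefix v s t : FC v (v, s ++ t) -> FC v (v, s).
Proof. by case/FC_catP. Qed.

Lemma prng_rcons v s (x : dedge E) : prng (v, rcons s x) = drng x.
Proof. by rewrite /prng /= map_rcons last_rcons. Qed.

(** * Reduction of words *)

Lemma red_id s : sorted nobacktrack s -> foldr (@red_cons E) [::] s = s.
Proof.
elim: s => [//|x [|y s] IHs] //= /andP[xy ys]; have /= -> := IHs ys.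
by rewrite /= ifN.
Qed.

Lemma red_reduced s t :
  sorted nobacktrack t -> sorted nobacktrack (foldr (@red_cons E) t s).
Proof.
move=> rt; elim: s => [//|x s] /=; case: (foldr _ _ _) => [//|y u] /= yu.
case: ifPn => [_|xy]; first exact: path_sorted yu.
by rewrite /= /nobacktrack xy.
Qed.

Lemma red_consK (x : dedge E) t :
  sorted nobacktrack t -> red_cons (dinv x) (red_cons x t) = t.
Proof.
case: t => [|y t] /=; first by rewrite dinvK eqxx.
move=> yt; case: ifPn => [/eqP def_y|_]; last by rewrite /= dinvK eqxx.
rewrite {}def_y in yt *; case: t yt => [//|z t] /= /andP[xz _].
by rewrite ifN.
Qed.

(** Reducing [s^-1 s t] gives [t]: this is how a common prefix disappears when
two paths are compared. *)
Lemma red_cancel s t : sorted nobacktrack t ->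
  foldr (@red_cons E) (foldr (@red_cons E) t s) (rev (map (@dinv E) s)) = t.
Proof.
move=> rt; elim: s => [//|x s IHs] /=.
by rewrite rev_cons -cats1 foldr_cat /= red_consK ?IHs //; apply: red_reduced.
Qed.

Lemma step_nobacktrack s : sorted step s -> sorted nobacktrack s.
Proof. by apply: sub_sorted => a b /andP[]. Qed.

(** In a product with one letter there are two cases: the letter undoes the last
step of the path, or it prolongs the path. *)
Lemma pdot_back v s a :
  FC v (v, rcons s a) -> pdot (v, rcons s a) (letter (dinv a)) = (v, s).
Proof.
move=> /FCP[_ _ /= /step_nobacktrack]; rewrite -cats1 => /sorted_catP[rs _ _].
rewrite /pdot /red /= -catA foldr_cat /= eqxx -[in RHS](red_id rs).
by [].
Qed.

Lemma pdot_forth v s (x : dedge E) :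
  FC v (v, s) -> (forall s' a, s = rcons s' a -> x <> dinv a) ->
  pdot (v, s) (letter x) = (v, rcons s x).
Proof.
move=> /FCP[_ _ /= /step_nobacktrack rs] nx.
rewrite /pdot /red /= red_id ?cats1 //; rewrite -cats1; apply/sorted_catP.
by split=> // s' a t b /nx xa [<-] _; apply/eqP.
Qed.

(** * Compatibility *)

Lemma common_prefix s t :
  exists h s' t', [/\ s = h ++ s', t = h ++ t' &
    forall a b s1 t1, s' = a :: s1 -> t' = b :: t1 -> a <> b].
Proof.
elim: s t => [|x s IHs] t; first by exists [::], [::], t.
case: t => [|y t]; first by exists [::], (x :: s), [::].
have [<-|xy] := eqVneq x y; last first.
  by exists [::], (x :: s), (y :: t); split=> // a b s1 t1 [<- _] [<- _]; apply/eqP.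
have [h [s' [t' [-> -> st]]]] := IHs t.
by exists (x :: h), s', t'.
Qed.

Lemma sorted_inverse (e : rel (dedge E)) s :
  (forall a b, e (dinv b) (dinv a) = e a b) ->
  sorted e (rev (map (@dinv E) s)) = sorted e s.
Proof.
by move=> eE; rewrite rev_sorted sorted_map; apply: eq_sorted => a b; apply: eE.
Qed.

Lemma prng_inverse v s : walk v s ->
  prng (prng (v, s), rev (map (@dinv E) s)) = v.
Proof.
case: s => [//|x s] /= /andP[/eqP <- _].
by rewrite /prng /= rev_cons map_rcons last_rcons drng_dinv.
Qed.

Lemma walk_inverse v s : walk v s ->
  walk (prng (v, s)) (rev (map (@dinv E) s)).
Proof.
elim: s v => [//|x s IHs] v /= /andP[_ ws].
rewrite rev_cons -cats1 walk_cat /= andbT.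
have -> : prng (v, x :: s) = prng (drng x, s) by [].
by rewrite IHs //= dsrc_dinv eq_sym; apply/eqP; exact: prng_inverse.
Qed.

(** Once the common prefix has cancelled no further reduction occurs, since the
two remainders start with different letters. *)
Lemma red_common_prefix v h s t :
  FC v (v, h ++ s) -> FC v (v, h ++ t) ->
  (forall a b s1 t1, s = a :: s1 -> t = b :: t1 -> a <> b) ->
  red (pcat (pinv (v, h ++ t)) (v, h ++ s)) =
    (prng (v, h ++ t), rev (map (@dinv E) t) ++ s).
Proof.
move=> /FC_catP[_ _ /step_nobacktrack rs _].
move=> /FC_catP[_ _ /step_nobacktrack rt _] st.
rewrite /red /pcat /pinv /=; congr pair.
rewrite map_cat rev_cat -catA foldr_cat catA.
have rhs : forall u, sorted nobacktrack u -> foldr (@red_cons E) [::]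
   (rev (map (@dinv E) h) ++ h ++ u) = u.
  by move=> u ru; rewrite !foldr_cat (red_id ru) red_cancel.
rewrite -[in LHS]catA rhs // -[X in foldr _ X _](red_id rs) -foldr_cat.
apply: red_id; apply/sorted_catP; split=> //.
  by rewrite sorted_inverse //; exact: nobacktrack_dinv.
move=> s' a t' b; case: t st {rt} => [|c t] st /=; first by case: s'.
rewrite rev_cons => /rcons_inj[_ <-] def_s.
by rewrite /nobacktrack dinvK; apply/eqP; exact: st def_s _.
Qed.

(** The reduction of [t^-1 s] consists of an inverse of a piece of [t] followed by
a piece of [s]. Both are separated, so only the junction can contain a forbidden
turn, and it does exactly when [s] and [t] diverge along distinct edges of one
part. *)
Lemma C_compatibleP v s t : FC v (v, s) -> FC v (v, t) ->
  (C_compatible v (v, s) (v, t) <->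
   forall h x y, prefix (rcons h (inl x)) s -> prefix (rcons h (inl y)) t ->
     same_part x y -> x = y).
Proof.
move=> Fs Ft; split.
  move=> + h x y /prefixP[s' def_s] /prefixP[t' def_t] xy.
  case=> [[e]|[e]|]; [by case: (h) def_s; rewrite e|by case: (h) def_t; rewrite e|].
  move: Fs Ft; rewrite def_s def_t !cat_rcons => Fs Ft.
  have [//|/eqP nxy] := eqVneq x y.
  rewrite red_common_prefix //; last by move=> a b ? ? [<- _] [<- _] [].
  case/C_separatedP => _ /=; rewrite rev_cons => /sorted_catP[_ _].
  move=> /(_ _ _ _ _ erefl erefl) /andP[_ /asboolP[]].
  by exists y, x; split=> //; apply: same_part_sym.
move=> st; have [h [s' [t' [def_s def_t nst]]]] := common_prefix s t.
apply: Or33; rewrite def_s def_t in Fs Ft *; rewrite red_common_prefix //.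
have /FC_catP[_ ws es _] := Fs; have /FC_catP[_ wt et _] := Ft.
have eht : prng (v, h ++ t') = prng (prng (v, h), t').
  by rewrite /prng /= map_cat last_cat.
rewrite eht; apply/C_separatedP; split.
  rewrite walk_cat walk_inverse //=.
  by rewrite -/(prng (prng (prng (v, h), t'), _)) prng_inverse.
apply/sorted_catP; split=> //; first by rewrite sorted_inverse //; exact: step_dinv.
move=> u a u' b; case: t' => [|c t'] in def_t wt et nst eht Ft * => /=.
  by case: u.
rewrite rev_cons => /rcons_inj[_ <-] def_s'; apply/andP; split.
  by rewrite /nobacktrack dinvK; apply/eqP; exact: nst def_s' _.
apply/asboolP => -[x [y [ec eb xy]]].
have {}ec : c = inl x by rewrite -[c]dinvK ec.
case: (nst b c u' t') => //; rewrite eb ec; congr inl.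
apply: (st h); last exact: same_part_sym.
  by rewrite def_s def_s' eb -cat_rcons prefix_prefix.
by rewrite def_t ec -cat_rcons prefix_prefix.
Qed.

(** * Lower compatible sets as trees *)

Definition tree v Z : Prop :=
  [/\ Z `<=` FC v, Z (vpath v),
      forall s a, Z (v, rcons s a) -> Z (v, s) &
      forall s x y, Z (v, rcons s (inl x)) -> Z (v, rcons s (inl y)) ->
        same_part x y -> x = y].

Lemma tree_src v Z w : tree v Z -> Z w -> w = (v, w.2).
Proof. by case: w => v' s [ZF _ _ _] /ZF/FCP[/= -> _ _]. Qed.

Lemma tree_prefix v Z s t : tree v Z -> prefix s t -> Z (v, t) -> Z (v, s).
Proof.
move=> [_ _ Zp _] /prefixP[u ->].
by elim/last_ind: u => [|u a IHu]; rewrite ?cats0 // -rcons_cat => /Zp.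
Qed.

(** In a lower set the divergence of two paths is witnessed by their prefixes,
so compatibility becomes a condition on the children of each node. *)
Lemma treeP v Z :
  tree v Z <-> [/\ Z !=set0, lower_subset v Z & C_compatible_set v Z].
Proof.
split=> [Zt|[[w Zw] [ZF Zl] [_ Zc]]].
  have [ZF Zv Zp Zs] := Zt; split; first by exists (vpath v).
  - split=> // -[v' m] n /FCP[/= -> _ _] [/= _ mn] Zn.
    by apply: tree_prefix mn _ => //; rewrite -(tree_src Zt Zn).
  - split=> // -[v1 g] [v2 n] Zg Zn.
    have [[e1 _ _] [e2 _ _]] := ((FCP v _).1 (ZF _ Zg), (FCP v _).1 (ZF _ Zn)).
    rewrite /= in e1 e2; subst v1 v2.
    apply/(C_compatibleP (ZF _ Zg) (ZF _ Zn)) => h x y hg hn.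
    by apply: (Zs h); [exact: tree_prefix hg Zg | exact: tree_prefix hn Zn].
split=> // [|s a Zsa|s x y Zx Zy].
- apply: (Zl _ w (FC_vpath v)) => //.
  by have [e _ _] := (FCP v w).1 (ZF w Zw); split; rewrite ?prefix0s.
- apply: (Zl _ _ _ _ Zsa); last by split=> //=; exact: prefix_rcons.
  by have /FC_rconsP[] := ZF _ Zsa.
- have := (C_compatibleP (ZF _ Zx) (ZF _ Zy)).1 (Zc _ _ Zx Zy) s x y.
  by rewrite !prefix_refl; apply.
Qed.

Definition trim Z : set (word E) :=
  [set w | exists w', [/\ Z w', prefix_le w w' & ~ ends_in_inverse w']].

Lemma frakF_atP v Z : frakF_at v Z <-> tree v Z /\ Z `<=` trim Z.
Proof.
split=> [[Z0 Zl Zc Zt]|[/treeP[Z0 Zl Zc] Zt]]; last by split.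
by split; first exact/treeP.
Qed.

Lemma not_ends_vpath v : ~ ends_in_inverse (vpath v).
Proof. by case=> [[|? ?] [?]]. Qed.

Lemma not_ends_edge v s (x : edge E) : ~ ends_in_inverse (v, rcons s (inl x)).
Proof. by case=> [t [e /rcons_inj[]]]. Qed.

Definition inverses (es : seq (edge E)) : seq (dedge E) := map inr es.

Lemma inverse_tail s : exists t es,
  s = t ++ inverses es /\ forall v, ~ ends_in_inverse (v, t).
Proof.
elim/last_ind: s => [|s a [t [es [-> nt]]]].
  by exists [::], [::]; split=> // v; exact: not_ends_vpath.
case: a => [e|e].
  exists (rcons (t ++ inverses es) (inl e)), [::]; rewrite cats0.
  by split=> // v; exact: not_ends_edge.
by exists t, (rcons es e); rewrite rcons_cat /inverses map_rcons.
Qed.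

Lemma prefix_rcons_split s t a :
  prefix s (rcons t a) -> s = rcons t a \/ prefix s t.
Proof.
case/prefixP => u; case/lastP: u => [|u b]; first by rewrite cats0; left.
by rewrite -rcons_cat => /rcons_inj[-> _]; right; exact: prefix_prefix.
Qed.

Lemma prefix_inverses v s t es :
  prefix s (t ++ inverses es) -> ~ ends_in_inverse (v, s) -> prefix s t.
Proof.
elim/last_ind: es => [|es e IHes]; first by rewrite cats0.
rewrite /inverses map_rcons -rcons_cat => /prefix_rcons_split[->|/IHes //].
by case; exists (t ++ inverses es), e.
Qed.

Lemma trim_sub v Z : tree v Z -> trim Z `<=` Z.
Proof.
move=> Zt w [w' [Zw' [ew ww'] _]].
rewrite [w]surjective_pairing; move: ew; rewrite /psrc (tree_src Zt Zw') /= => ->.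
by apply: tree_prefix ww' _ => //; rewrite -(tree_src Zt Zw').
Qed.

Lemma trim_mem Z w : Z w -> ~ ends_in_inverse w -> trim Z w.
Proof. by move=> Zw nw; exists w; split=> //; split=> //; exact: prefix_refl. Qed.

Lemma prefix_le_trans : forall w1 w2 w3 : word E,
  prefix_le w1 w2 -> prefix_le w2 w3 -> prefix_le w1 w3.
Proof.
move=> w1 w2 w3 [e12 p12] [e23 p23].
by split; [rewrite e12 | exact: prefix_trans p12 p23].
Qed.

Lemma trim_frakF v Z : tree v Z -> frakF_at v (trim Z).
Proof.
move=> Zt; have [ZF Zv Zp Zs] := Zt; have sub := trim_sub Zt.
apply/frakF_atP; split; last first.
  move=> w [w' [Zw' ww' nw']]; exists w'; split=> //; exact: trim_mem.
split=> [w /sub/ZF //||s a [w' [Zw' ww' nw']]|s x y /sub Zx /sub]; last exact: Zs.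
- by apply: trim_mem => //; exact: not_ends_vpath.
- exists w'; split=> //; apply: prefix_le_trans ww'; split=> //=.
  exact: prefix_rcons.
Qed.

(** * Finite compatible sets *)

Definition prefixes v s : set (word E) := [set w | w.1 = v /\ prefix w.2 s].

Lemma prefixes_sub v Z s : tree v Z -> Z (v, s) -> prefixes v s `<=` Z.
Proof. by move=> Zt Zs [v' t] [/= -> ts]; exact: tree_prefix ts Zs. Qed.

Lemma prefix_rcons_inj h s a b :
  prefix (rcons h a) s -> prefix (rcons h b) s -> a = b.
Proof.
move=> /prefixP[p ->] /prefixP[q]; rewrite !cat_rcons.
by elim: h => [[]//|c h IHh] /= [].
Qed.

Lemma prefixes_tree v s : FC v (v, s) -> tree v (prefixes v s).
Proof.
move=> Fs; split=> [[v' t] [/= -> /prefixP[u e]]|||].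
- by rewrite e in Fs; exact: FC_prefix Fs.
- by split; rewrite /= ?prefix0s.
- move=> t a [_ /= ta]; split=> //=; apply: prefix_trans ta; exact: prefix_rcons.
- by move=> h x y [_ /= hx] [_ /= hy] _; have [] := prefix_rcons_inj hx hy.
Qed.

Lemma finite_prefixes v s : finite_set (prefixes v s).
Proof.
apply: (@sub_finite_set _ _ ((fun k => (v, take k s) : word E) @` `I_(size s).+1)).
  move=> [v' t] [/= -> ts]; exists (size t); last first.
    by move: ts; rewrite prefixE => /eqP ->.
  by rewrite /= ltnS; exact: size_prefix.
exact/finite_image/finite_II.
Qed.

Lemma prefixes_X0 v s :
  FC v (v, s) -> ~ ends_in_inverse (v, s) -> X0 (prefixes v s).
Proof.
move=> Fs ns; split.
  have /treeP[P0 Pl Pc] := prefixes_tree Fs.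
  by exists v; split=> //; exact: finite_prefixes.
move=> [v' t] [[/= -> ts] /(_ (v, s))] e.
by rewrite -e //; split=> //; exact: prefix_refl.
Qed.

(** The condition on maximal elements suffices because in a finite set every
element lies below a maximal one. *)
Lemma X0_frakF J : X0 J -> exists v, frakF_at v J.
Proof.
move=> [[v [J0 fJ Jl Jc]] Jmax]; exists v; split=> //.
have [js defJ] := (finite_seqP J).1 fJ.
pose N := \max_(w <- js) size w.2.
have bound w : J w -> size w.2 <= N.
  by rewrite defJ /= => wJ; exact: leq_bigmax_seq.
suff main k : forall z, J z -> N - size z.2 < k ->
    exists z', [/\ J z', prefix_le z z' & ~ ends_in_inverse z'].
  by move=> z Jz; exact: main (ltnSn _).
elim: k => [//|k IHk] z Jz zk.
have [zmax|] := pselect (maximal_in J z).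
  by exists z; split=> //; [split=> //; exact: prefix_refl | exact: Jmax].
move=> /not_andP[//|] /existsNP[z' /not_implyP[Jz' /not_implyP[zz' nz']]].
have [|z'' [Jz'' z'z'' nz'']] := IHk z' Jz'; last first.
  by exists z''; split=> //; exact: prefix_le_trans zz' z'z''.
have szz' : size z.2 < size z'.2.
  have [ez /prefixP[u eu]] := zz'; rewrite eu size_cat -addn1 leq_add2l.
  case: u eu => // eu; case: nz'; rewrite [z]surjective_pairing [z']surjective_pairing.
  by rewrite eu cats0; congr pair.
have := bound z' Jz'; lia.
Qed.
(** * Saturated trees *)

(** The finite-maximal condition on all local configurations, restricted to the
letters that prolong the node [s]. A letter undoing the last step of [s]
belongs to the local configuration at [s] in any case, and if it is an edge of
the part [X] then [FC v (v, rcons s (inl z0))] fails. *)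
Definition saturated v Z : Prop :=
  [/\ tree v Z,
      forall s x, Z (v, s) -> FC v (v, rcons s (inr x)) ->
        Z (v, rcons s (inr x)) &
      forall s X z0, Z (v, s) -> sep_fin (prng (v, s)) X -> X z0 ->
        FC v (v, rcons s (inl z0)) ->
        exists2 z, X z & Z (v, rcons s (inl z))].

(** The candidate for the saturated tree whose trimming is [Z]: saturation forces
all tails of inverse edges to be present, and trimming removes them. *)
Definition grow v Z : set (word E) :=
  [set w | FC v w /\ exists t es, w.2 = t ++ inverses es /\ Z (v, t)].

Lemma sub_grow v Z : tree v Z -> Z `<=` grow v Z.
Proof.
move=> Zt w Zw; have [ZF _ _ _] := Zt.
split; first exact: ZF.
by exists w.2, [::]; rewrite cats0 -(tree_src Zt Zw).
Qed.

Lemma grow_mem v Z w :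
  tree v Z -> grow v Z w -> ~ ends_in_inverse w -> Z w.
Proof.
move=> Zt [Fw [t [es [ew Zvt]]]] nw; have [e _ _] := (FCP v w).1 Fw.
rewrite [w]surjective_pairing e; apply: tree_prefix Zvt => //.
by apply: (@prefix_inverses w.1 _ _ es); rewrite -?ew ?prefix_refl -?surjective_pairing.
Qed.

Lemma grow_tree v Z : tree v Z -> tree v (grow v Z).
Proof.
move=> Zt; have [ZF Zv Zp Zs] := Zt; split=> [w []//||s a|s x y].
- exact: sub_grow.
- move=> [/FC_rconsP[Fs _ _] /= [t [es]]]; case/lastP: es => [|es e] [def_t Zvt].
    rewrite cats0 in def_t; rewrite -def_t in Zvt.
    exact: sub_grow (Zp _ _ Zvt).
  split=> //; exists t, es; split=> //.
  by move: def_t; rewrite /inverses map_rcons -rcons_cat => /rcons_inj[].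
- by move=> /(grow_mem Zt)-/(_ (@not_ends_edge _ _ _)) Zx
            /(grow_mem Zt)-/(_ (@not_ends_edge _ _ _)); exact: Zs.
Qed.

Lemma trim_grow v Z : frakF_at v Z -> trim (grow v Z) = Z.
Proof.
move=> /frakF_atP[Zt Ztrim]; apply/seteqP; split=> [w [w' [gw' ww' nw']]|w /Ztrim].
  apply: (trim_sub Zt); exists w'; split=> //; exact: grow_mem gw' nw'.
move=> [w' [Zw' ww' nw']]; exists w'; split=> //; exact: sub_grow.
Qed.

Lemma saturated_inverses v Z t es : saturated v Z ->
  Z (v, t) -> FC v (v, t ++ inverses es) -> Z (v, t ++ inverses es).
Proof.
move=> [_ Zi _] Zvt; elim/last_ind: es => [|es e IHes]; first by rewrite cats0.
rewrite /inverses map_rcons -rcons_cat => Fe; apply: Zi => //.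
by apply: IHes; have /FC_rconsP[] := Fe.
Qed.

Lemma grow_trim v Z : saturated v Z -> grow v (trim Z) = Z.
Proof.
move=> Zsat; have [Zt _ _] := Zsat; have [ZF _ _ _] := Zt.
apply/seteqP; split=> [[v' s] [Fw /= [t [es [def_s /(trim_sub Zt) Zvt]]]]|w Zw].
  have [/= e _ _] := (FCP _ _).1 Fw; subst v' s.
  exact: saturated_inverses.
split; first exact: ZF.
have [t [es [ew nt]]] := inverse_tail w.2; exists t, es; split=> //.
apply: trim_mem (nt v); apply: (@tree_prefix v Z t w.2) => //.
  by rewrite ew prefix_prefix.
by rewrite -(tree_src Zt Zw).
Qed.

(** * Enlarging a tree by one branch *)

(** A forbidden turn into [y] would be one into [x] as well, and undoing the last
step by [y] would make the step into [x] a forbidden turn or a backtrack. *)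
Lemma FC_same_part v s (x y : edge E) :
  same_part x y -> FC v (v, rcons s (inl x)) -> FC v (v, rcons s (inl y)).
Proof.
move=> xy /FC_rconsP[Fs ex st]; apply/FC_rconsP; split=> //.
  have [v' [X [vX Xx Xy]]] := xy.
  by rewrite -ex /= (part_src vX Xx) (part_src vX Xy).
move=> s' a /st /andP[xa /asboolP nxa].
have na : ~ turn a (inl y).
  apply: contra_not nxa => -[z [y' [-> [<-] zy]]]; exists z, x; split=> //.
  have [v' [X [vX Xx Xy]]] := xy; exists v', X; split=> //.
  by apply: same_part_in vX Xy _; exact: same_part_sym.
apply/andP; split; last exact/asboolP.
apply/eqP => def_y; apply: na; exists y, y; split=> //.
  by rewrite -[a]dinvK -def_y.
by have [v' [X [vX _ Xy]]] := xy; exists v', X.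
Qed.

(** Only the prefixes of [s] that do not end in an inverse edge have to lie in
[Y]: a conflict with [Y] happens at an edge, and every prefix of the new branch
ending in an edge is either such a prefix of [s] or the new branch itself. The
tail of inverse edges of [s] comes along with the branch. *)
Lemma graft v Y s (x : edge E) : frakF_at v Y ->
  FC v (v, rcons s (inl x)) ->
  (forall t, prefix t s -> ~ ends_in_inverse (v, t) -> Y (v, t)) ->
  (forall y, same_part x y -> ~ Y (v, rcons s (inl y))) ->
  frakF_at v (Y `|` prefixes v (rcons s (inl x))).
Proof.
move=> /frakF_atP[Yt Ytrim] Fx Ys Yx.
have [YF Yv Yp Ysep] := Yt; have [PF Pv Pp Psep] := prefixes_tree Fx.
have cross h y z : Y (v, rcons h (inl y)) ->
    prefixes v (rcons s (inl x)) (v, rcons h (inl z)) -> same_part y z -> y = z.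
  move=> Yy [_ /= /prefix_rcons_split[/rcons_inj[eh [ez]]|hs]] yz.
    by subst h z; case: (Yx y) => //; exact: same_part_sym.
  by apply: (Ysep h) => //; apply: Ys hs _; exact: not_ends_edge.
apply/frakF_atP; split; last first.
  move=> w [/Ytrim[w' [Yw' ww' nw']]|[ew pw]].
    by exists w'; split=> //; left.
  exists (v, rcons s (inl x)); split=> //; last exact: not_ends_edge.
  by right; split=> //=; exact: prefix_refl.
split=> [w [/YF|/PF] //||h a [/Yp|/Pp]|h y z].
- by left.
- by left.
- by right.
case=> [Yy|Py] [Yz|Pz] yz; first exact: Ysep Yy Yz yz.
- exact: cross Yy Pz yz.
- by apply/esym; exact: cross Yz Py (same_part_sym yz).
- exact: Psep Py Pz yz.
Qed.

(** * Tight filters *)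

Lemma frakTP (Z : frakF E) : frakT E Z <->
  forall IG, basic_dom IG -> basic_open IG Z ->
    exists2 Y, frakU E Y & basic_open IG Y.
Proof.
rewrite /frakT /closure; split=> [ZT IG dIG oIG|ZT B].
  have [|Y [UY oY]] := ZT (basic_open IG); last by exists Y.
  apply: open_nbhs_nbhs; split=> //.
  by exists [set IG]; [move=> _ -> | rewrite bigcup_set1].
rewrite nbhsE => -[O [[D' D'D <-] [IG D'IG oIG]] OB].
have [Y UY oY] := ZT IG (D'D _ D'IG) oIG.
by exists Y; split=> //; apply: OB; exists IG.
Qed.

Lemma frakF_src v (Z : frakF E) : \val Z (vpath v) -> frakF_at v (\val Z).
Proof.
move=> Zv; have /set_mem[v' Zv'] := valP Z.
by have /frakF_atP[/tree_src/(_ Zv)[->]] := Zv'.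
Qed.

Lemma frakUP v (Y : frakF E) Z :
  frakU E Y -> \val Y (vpath v) -> frakF_at v Z -> \val Y `<=` Z -> Z `<=` \val Y.
Proof.
move=> UY Yv FZ YZ; have ZF : Z \in @frakF_set E by rewrite inE; exists v.
by have <- := UY (SigSub ZF) YZ.
Qed.

(** If the finite part [X] were missed at [s], tightness would provide an
ultrafilter which still contains the core of [s] and avoids [X] altogether, so
that it could be enlarged by a branch through [X]. Finiteness of [X] is what
makes avoiding [X] an open condition. *)
Lemma grow_saturated v (Z : frakF E) :
  frakT E Z -> \val Z (vpath v) -> saturated v (grow v (\val Z)).
Proof.
move=> /frakTP ZT Zv; have /frakF_atP[Zt _] := frakF_src Zv.
have gt := grow_tree Zt; split=> // [s x [Fs [t [es [/= -> Zvt]]]] Fx|s X z0 gs].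
  by split=> //; exists t, (rcons es x); rewrite /inverses map_rcons -rcons_cat.
move=> [vX finX] Xz0 Fz0; apply: contrapT => /forall2NP nX.
have [t [es [def_s nt]]] := inverse_tail s.
have Zvt : \val Z (v, t).
  apply: (grow_mem Zt _ (nt v)); apply: (tree_prefix gt _ gs).
  by rewrite def_s prefix_prefix.
have Fz z : X z -> FC v (v, rcons s (inl z)).
  by move=> Xz; apply: FC_same_part Fz0; exists (prng (v, s)), X.
pose G := [set prefixes v (rcons s (inl z)) | z in X].
have [||Y UY [/= tY GY]] := ZT (prefixes v t, G).
- split=> /=; [|exact: finite_image|].
    by apply: prefixes_X0 (nt v); have [ZF _ _ _] := Zt; exact: ZF.
  by move=> _ [z Xz <-]; apply: prefixes_X0; [exact: Fz | exact: not_ends_edge].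
- split=> /=; first exact: prefixes_sub.
  move=> _ [z Xz <-] /(_ (v, rcons s (inl z))) Zz.
  case: (nX z) => //; apply; apply: sub_grow => //; apply: Zz.
  by split=> //=; exact: prefix_refl.
have Yv : \val Y (vpath v) by apply: tY; split=> //=; exact: prefix0s.
have FY := frakF_src Yv; have /frakF_atP[Yt _] := FY.
have nY z : same_part z0 z -> ~ \val Y (v, rcons s (inl z)).
  move=> /(same_part_in vX Xz0) Xz Yz.
  by case: (GY (prefixes v (rcons s (inl z)))); [exists z | exact: prefixes_sub].
apply: (nY z0); first by exists (prng (v, s)), X.
apply: (frakUP UY Yv (graft FY Fz0 _ nY)) => [u us nu|w Yw|]; last 2 first.
- by left.
- by right; split=> //=; exact: prefix_refl.
apply: tY; split=> //=; apply: (@prefix_inverses v _ _ es) => //.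
by rewrite -def_s.
Qed.
Lemma exit_point v Z s : tree v Z -> ~ Z (v, s) ->
  exists h a, [/\ prefix (rcons h a) s, Z (v, h) & ~ Z (v, rcons h a)].
Proof.
move=> [_ Zv _ _]; elim/last_ind: s => [//|s a IHs] nZ.
have [Zs|/IHs[h [b [hs Zh nZb]]]] := pselect (Z (v, s)).
  by exists s, a; split=> //; exact: prefix_refl.
exists h, b; split=> //; apply: prefix_trans hs _; exact: prefix_rcons.
Qed.

(** Unions of chains preserve all conditions, since each of them involves at most
two paths at a time. *)
Lemma maximal_avoiding v Z (B : set (word E)) :
  frakF_at v Z -> Z `&` B = set0 ->
  exists Y, [/\ frakF_at v Y, Z `<=` Y, Y `&` B = set0 &
    forall Y', frakF_at v Y' -> Y `<=` Y' -> Y' `&` B = set0 -> Y' `<=` Y].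
Proof.
move=> FZ ZB.
(* Zorn's lemma also tests the empty chain, whence the union with [Z]. *)
pose P W := frakF_at v (Z `|` W) /\ (Z `|` W) `&` B = set0.
have [W [[FW WB] Wmax]] : exists W, P W /\ forall W', W `<` W' -> ~ P W'.
  apply: Zorn_bigcup => F FP Ftot; rewrite /P.
  set U := Z `|` _.
  have hull w1 w2 : U w1 -> U w2 -> exists W,
      [/\ P W, Z `|` W `<=` U, (Z `|` W) w1 & (Z `|` W) w2].
    have sub W : F W -> Z `|` W `<=` U.
      by move=> FW w [Zw|Ww]; [left | right; exists W].
    case=> [Z1|[W1 FW1 W1w]] [Z2|[W2 FW2 W2w]].
    - exists set0; rewrite /P setU0; split=> //; exact: subsetUl.
    - by exists W2; split; [exact: FP|exact: sub|left|right].
    - by exists W1; split; [exact: FP|exact: sub|right|left].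
    - have [W12|W21] := Ftot _ _ FW1 FW2.
        by exists W2; split; [exact: FP|exact: sub|right; exact: W12|right].
      by exists W1; split; [exact: FP|exact: sub|right|right; exact: W21].
  split; last first.
    rewrite -subset0 => w [Uw Bw]; have [W [[_ WB] _ Ww _]] := hull _ _ Uw Uw.
    by rewrite -WB.
  apply/frakF_atP; split; [split=> [w Uw||s a Us|s x y Ux Uy xy]|move=> w Uw].
  - have [W [[/frakF_atP[[WF _ _ _] _] _] _ Ww _]] := hull _ _ Uw Uw; exact: WF.
  - by left; have /frakF_atP[[_ Zv _ _] _] := FZ.
  - have [W [[/frakF_atP[[_ _ Wp _] _] _] WU Ws _]] := hull _ _ Us Us.
    exact/WU/(Wp _ _ Ws).
  - have [W [[/frakF_atP[[_ _ _ Wsep] _] _] _ Wx Wy]] := hull _ _ Ux Uy.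
    exact: Wsep Wx Wy xy.
  - have [W [[/frakF_atP[_ Wt] _] WU Ww _]] := hull _ _ Uw Uw.
    by have [w' [/WU Uw' ww' nw']] := Wt _ Ww; exists w'.
exists (Z `|` W); split=> // Y' FY' WY' Y'B.
have ZY' : Z `|` Y' = Y' by apply/setUidPr => w Zw; apply: WY'; left.
apply: contrapT => nsub; apply: (Wmax Y'); last by rewrite /P ZY'.
split=> [w Ww|Y'W]; first by apply: WY'; right.
by apply: nsub => w /Y'W; right.
Qed.

(** A tree [Y'] larger than [Y] meets [B], hence contains the first path
[rcons h a] outside [S] below an element of [B], which lies in [B] by the
closure hypothesis. Saturation makes [a] an edge of an infinite part that
neither [S] nor [Y] uses at [h], and this part has room for a branch avoiding
[B]: this is incompatible with the maximality of [Y] among the trees avoiding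
[B]. *)
Lemma avoiding_maximal v S Y (B : set (word E)) :
  saturated v S -> finite_set B ->
  (forall w, B w -> ~ S w) ->
  (forall h a s, prefix (rcons h a) s -> B (v, s) -> ~ S (v, rcons h a) ->
     B (v, rcons h a)) ->
  frakF_at v Y -> trim S `<=` Y -> Y `&` B = set0 ->
  (forall Y', frakF_at v Y' -> Y `<=` Y' -> Y' `&` B = set0 -> Y' `<=` Y) ->
  forall Y', frakF_at v Y' -> Y `<=` Y' -> Y' `<=` Y.
Proof.
move=> [St Sinv Sfin] finB BS Blow FY SY YB Ymax Y' FY' YY'.
have /frakF_atP[Yt' _] := FY'; have [YF' _ _ Ysep'] := Yt'.
apply: (Ymax) => //; rewrite -subset0 => w [Yw Bw].
have ew := tree_src Yt' Yw; rewrite {}ew in Yw Bw.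
have [h [a [hw Sh nSa]]] := exit_point St (BS _ Bw).
have {Blow} Ba := Blow _ _ _ hw Bw nSa.
have {hw Yw Bw} Ya := tree_prefix Yt' hw Yw.
have Fa := YF' _ Ya.
case: a => [x|x] in Ba Ya Fa nSa *; last by apply: nSa; exact: Sinv.
have [cov _ _] := sepP (prng (v, h)).
have [X vX Xx] : (\bigcup_(X in sep (prng (v, h))) X) x.
  by rewrite -/(cover _ id) cov; have /FC_rconsP[] := Fa.
have SX z : X z -> ~ S (v, rcons h (inl z)).
  move=> Xz Sz; have Yz : Y' (v, rcons h (inl z)).
    by apply/YY'/SY/trim_mem => //; exact: not_ends_edge.
  have xz : same_part x z by exists (prng (v, h)), X.
  by apply: nSa; rewrite (Ysep' _ _ _ Ya Yz xz).
have infX : infinite_set X.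
  by move=> finX; have [z Xz /SX] := Sfin _ _ _ Sh (conj vX finX) Xx Fa; apply.
(* The paths [h z], [z] in [X], are distinct, so [B] cannot contain them all. *)
have [z Xz nBz] : exists2 z, X z & ~ B (v, rcons h (inl z)).
  apply: contrapT => /forall2NP nX; apply: infX.
  apply: (@sub_finite_set _ _ ((fun z => (v, rcons h (inl z)) : word E) @^-1` B)).
    by move=> z Xz; case: (nX z) => // /contrapT.
  by apply: finite_preimage => // z1 z2 _ _ [] /rcons_inj[].
have nY y : same_part z y -> ~ Y (v, rcons h (inl y)).
  move=> /(same_part_in vX Xz) Xy Yy.
  have xy : same_part x y by exists (prng (v, h)), X.
  have exy := Ysep' _ _ _ Ya (YY' _ Yy) xy; rewrite -exy in Yy.
  by have : (Y `&` B) (v, rcons h (inl x)) by []; rewrite YB.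
have zz : same_part z z by exists (prng (v, h)), X.
have Fz : FC v (v, rcons h (inl z)) by apply: FC_same_part Fa; exists (prng (v, h)), X.
apply: (nY z zz); apply: (Ymax _ (graft FY Fz _ nY)).
- move=> t th nt; apply: SY; apply: trim_mem => //; exact: tree_prefix th Sh.
- by move=> u Yu; left.
- rewrite -subset0 => u [[Yu|[/= eu pu]] Bu]; first by rewrite -YB.
  rewrite [u]surjective_pairing eu in Bu.
  case/prefix_rcons_split: pu => [e|uh]; first by rewrite e in Bu.
  by apply: (BS _ Bu); exact: tree_prefix uh Sh.
- by right; split=> //=; exact: prefix_refl.
Qed.

(** Sets of [X0] are determined by their elements not ending in an inverse edge,
so such a set lies in [trim S] as soon as it lies in [S]. Hence avoiding the
sets of [G] follows from avoiding the finite set of paths of [G] outside [S]. *)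
Lemma trim_frakT v S (Z : frakF E) :
  saturated v S -> \val Z = trim S -> frakT E Z.
Proof.
move=> Ssat defZ; have [St _ _] := Ssat; apply/frakTP => -[I G].
move=> [/= _ finG GX] [/= IZ GZ].
pose B := (\bigcup_(J in G) J) `\` S.
have FZ := trim_frakF St.
have finB : finite_set B.
  apply/finite_setD/bigcup_finite => // J /GX[[u [_ ? _ _]] _] //.
have ZB : trim S `&` B = set0.
  by rewrite -subset0 => w [/(trim_sub St) Sw [_]].
have [Y [FY ZY YB Ymax]] := maximal_avoiding FZ ZB.
have Yin : Y \in @frakF_set E by rewrite inE; exists v.
exists (SigSub Yin) => [Y' /= YY'|].
  apply: val_inj => /=; apply/seteqP; split=> //.
  apply: (avoiding_maximal Ssat finB _ _ FY ZY YB Ymax) => //.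
  - by move=> w [].
  - move=> h a s hs [[J GJ Js] _] nSa; split=> //; exists J => //.
    have [u /frakF_atP[Jt _]] := X0_frakF (GX _ GJ).
    have [eu] := tree_src Jt Js; rewrite eu in Js *.
    exact: tree_prefix hs Js.
  - apply: frakF_src; apply: YY'; by have /frakF_atP[[]] := FY.
split=> [w /IZ|J GJ JY] /=; first by rewrite defZ; exact: ZY.
apply: (GZ J GJ); rewrite defZ => w Jw.
have [u /frakF_atP[Jt Jtrim]] := X0_frakF (GX _ GJ).
have [w' [Jw' ww' nw']] := Jtrim _ Jw; exists w'; split=> //.
apply: contrapT => nSw'; have : (Y `&` B) w' by split; [exact: JY | split=> //; exists J].
by rewrite YB.
Qed.

(** * Local configurations of a saturated tree *)

Lemma local_confP v Z s a : tree v Z -> Z (v, s) ->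
  local_conf Z (v, s) a <->
    Z (v, rcons s a) \/ exists s', s = rcons s' (dinv a).
Proof.
move=> [ZF _ Zp _] Zs; have Fs := ZF _ Zs; split=> [[ea]|[Za|[s' def_s]]].
- have [|nb] := pselect (exists s', s = rcons s' (dinv a)); first by right.
  rewrite pdot_forth //; first by left.
  by move=> s' b def_s eab; apply: nb; exists s'; rewrite eab dinvK.
- have /FC_rconsP[_ ea st] := ZF _ Za; split=> //.
  by rewrite pdot_forth // => s' b /st/andP[/eqP].
- rewrite def_s in Zs Fs *; split; first by rewrite prng_rcons drng_dinv.
  by rewrite -{2}[a]dinvK pdot_back //; exact: Zp Zs.
Qed.

Lemma local_conf_part v Z s (x y : edge E) : tree v Z -> Z (v, s) ->
  local_conf Z (v, s) (inl x) -> local_conf Z (v, s) (inl y) ->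
  same_part x y -> x = y.
Proof.
move=> Zt Zs; have [ZF _ _ Zsep] := Zt.
have back h z z' : same_part z z' ->
    ~ Z (v, rcons (rcons h (inr z)) (inl z')).
  move=> zz' /ZF/FC_rconsP[_ _ /(_ _ _ erefl)/andP[_ /asboolP]].
  by apply; exists z, z'.
move=> /(local_confP _ Zt Zs)[Zx|[h def_s]] /(local_confP _ Zt Zs)[Zy|[h' def_s']] xy.
- exact: Zsep Zx Zy xy.
- by rewrite def_s' in Zx; case: (back _ _ _ (same_part_sym xy) Zx).
- by rewrite def_s in Zy; case: (back _ _ _ xy Zy).
- by move: def_s'; rewrite def_s => /rcons_inj[].
Qed.

Lemma FC_letter v a : dsrc a = v -> FC v (v, [:: a]).
Proof. by move=> ea; apply/FCP; split=> //=; rewrite ea eqxx. Qed.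

Lemma finite_maximal_local_conf v Z g : saturated v Z -> nontrivial Z -> Z g ->
  finite_maximal (prng g) (local_conf Z g).
Proof.
move=> [Zt Zinv Zfin] [z1 [z2 [Zz1 Zz2 nz]]] Zg.
have eg := tree_src Zt Zg; rewrite {}eg in Zg *; move: g.2 Zg => {g} s Zs.
have [ZF _ _ _] := Zt; have Fs := ZF _ Zs.
have confP a := local_confP a Zt Zs; have part := local_conf_part Zt Zs.
split.
- split; first split=> [|a []//].
    case/lastP: s Zs {Fs confP part} => [|s a] Zs; last first.
      by exists (dinv a); apply/local_confP => //; right; exists s; rewrite dinvK.
    have [w Zw nw] : exists2 w, Z w & w <> vpath v.
      have [e|] := pselect (z1 = vpath v); last by exists z1.
      by exists z2 => // e'; apply: nz; rewrite e e'.
    have ew := tree_src Zt Zw; rewrite {}ew in Zw nw; case: w.2 Zw nw => [//|a t] Zw _.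
    exists a; apply/local_confP => //; left.
    by apply: (tree_prefix Zt _ Zw); rewrite /= eqxx prefix0s.
  split=> [_ [a [ea _] <-]|_ _ [a ca <-] [b cb <-]].
    by rewrite /letter ea; exact: FC_letter.
  have [[ea _] [eb _]] := (ca, cb); rewrite /letter ea eb.
  apply/C_compatibleP; [exact: FC_letter | exact: FC_letter |].
  move=> [|c [|d h]] x y /=; rewrite ?prefix0s ?andbT ?andbF //.
  by move=> /eqP xa /eqP yb; apply: part; rewrite ?xa ?yb.
- move=> X [vX finX]; have [_ _ /(_ X vX)[z0 Xz0]] := sepP (prng (v, s)).
  have [[z [s' [Xz def_s]]]|nback] :=
      pselect (exists z s', X z /\ s = rcons s' (inr z)).
    by exists z => //; apply/confP; right; exists s'.
  have [] // := Zfin s X z0 Zs (conj vX finX) Xz0; last first.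
    by move=> z Xz Zz; exists z => //; apply/confP; left.
  apply/FC_rconsP; split=> //; first exact: part_src vX Xz0.
  move=> s' c def_s; apply/andP; split; last first.
    apply/asboolP => -[z [z' [ec [ez] zz']]]; apply: nback; exists z, s'.
    rewrite -ec; split=> //; apply: same_part_in vX Xz0 _.
    by rewrite ez; exact: same_part_sym.
  apply/eqP => ec; apply: nback; exists z0, s'; split=> //.
  by rewrite def_s -[c]dinvK -ec.
- move=> x ex; apply/confP.
  have [|nback] := pselect (exists s', s = rcons s' (dinv (inr x))); first by right.
  left; apply: Zinv => //; apply/FC_rconsP; split=> // s' c def_s.
  apply/andP; split; last by apply/asboolP => -[z [z' []]].
  by apply/eqP => ec; apply: nback; exists s'; rewrite def_s ec dinvK.
Qed.

Lemma frakT'P Z :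
  frakT' E Z <-> exists v, saturated v Z /\ nontrivial Z.
Proof.
split=> [[v [[ZF Zl] Znt Zmax]]|[v [Zsat Znt]]]; last first.
  have [Zt _ _] := Zsat; have /treeP[_ Zl _] := Zt.
  exists v; split=> // g Zg; exact: finite_maximal_local_conf Zsat Znt Zg.
exists v; split=> //.
have Zp s a : Z (v, rcons s a) -> Z (v, s).
  move=> Za; apply: (Zl _ _ _ _ Za).
    by have /FC_rconsP[] := ZF _ Za.
  by split=> //=; exact: prefix_rcons.
have Zvt : Z (vpath v).
  have [w [_ [Zw _ _]]] := Znt; have [ew _ _] := (FCP v w).1 (ZF _ Zw).
  by apply: (Zl _ w (FC_vpath v)) => //; split; rewrite ?prefix0s.
have forth s a : Z (v, rcons s a) -> local_conf Z (v, s) a.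
  move=> Za; have /FC_rconsP[Fs ea st] := ZF _ Za; split=> //.
  by rewrite pdot_forth // => s' b /st/andP[/eqP].
have Zt : tree v Z.
  split=> // s x y Zx Zy xy; have Zs := Zp _ _ Zx.
  have [[_ [cF cc]] _ _] := Zmax _ Zs.
  have ix : (@letter E @` local_conf Z (v, s)) (letter (inl x)).
    by exists (inl x) => //; exact: forth.
  have iy : (@letter E @` local_conf Z (v, s)) (letter (inl y)).
    by exists (inl y) => //; exact: forth.
  have := cc _ _ ix iy; have := cF _ ix; have := cF _ iy; rewrite /letter.
  have [ex _] := forth _ _ Zx; have [ey _] := forth _ _ Zy; rewrite ex ey.
  move=> Fy Fx /(C_compatibleP Fx Fy)/(_ [::] x y); apply=> //;
  exact: prefix_refl.
split=> // [s x Zs Fx|s X z0 Zs finX Xz0 Fz0].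
  have [_ _ /(_ x)] := Zmax _ Zs.
  have /FC_rconsP[_ ex st] := Fx.
  case/(_ ex)/(local_confP _ Zt Zs) => // -[s' def_s].
  by have /andP[] := st _ _ def_s; rewrite /nobacktrack eqxx.
have [_ /(_ X finX)[z Xz cz] _] := Zmax _ Zs; exists z => //.
case/(local_confP _ Zt Zs): cz => // -[s' def_s].
have /FC_rconsP[_ _ /(_ _ _ def_s)/andP[_ /asboolP[]]] := Fz0.
by exists z, z0; split=> //; exists (prng (v, s)), X; case: finX.
Qed.

(** A tree whose only node is [v] is saturated exactly when saturation asks for
nothing at [v]: no incoming edge to travel backwards, no finite part to meet. *)
Lemma E0r_infP v : E0r_inf E v <-> saturated v [set vpath v].
Proof.
have single : prefixes v [::] = [set vpath v].
  apply/seteqP; split=> [[v' s] [/= -> ]|_ ->]; last by split.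
  by rewrite -/(prefix s [::]) prefixs0 => /eqP ->.
split=> [[norng inf]|[_ Zinv Zfin]].
  split; first by rewrite -single; exact/prefixes_tree/FC_vpath.
    move=> s x [->] /FC_rconsP[_ ex _].
    by have : (@rng E @^-1` [set v]) x by []; rewrite norng.
  by move=> s X z0 [->] [/inf].
split.
  rewrite -subset0 => x ex; have := Zinv [::] x erefl.
  by move=> /(_ (FC_letter _)) Zx; have [] := Zx ex.
move=> X vX finX; have [_ _ /(_ X vX)[z0 Xz0]] := sepP v.
have ez0 := part_src vX Xz0.
have := Zfin [::] X z0 erefl (conj vX finX) Xz0.
by move=> /(_ (@FC_letter v (inl z0) ez0))[z _ []].
Qed.

End TightFilters.

(** * The bijection *)

Theorem theorem5p14 (E : separated_graph)
    (noisolated : forall v : vertex E, ~ isolated_vertex v) :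
  exists f : (set_type (frakT' E) + set_type (E0r_inf E))%type ->
             set_type (frakT E),
    bijective f.
Proof.
pose S (p : set_type (frakT' E) + set_type (E0r_inf E)) : set (word E) :=
  match p with inl Z => \val Z | inr v => [set vpath (\val v)] end.
have Ssat p : exists v, saturated v (S p).
  case: p => [Z|v] /=.
    by have /set_mem/frakT'P[v [Zsat _]] := valP Z; exists v.
  by exists (\val v); apply/E0r_infP/set_mem/valP.
have Ssurj v Z : saturated v Z -> exists p, S p = Z.
  move=> Zsat; have [nt|tr] := pselect (nontrivial Z).
    have inT : Z \in frakT' E by rewrite inE; apply/frakT'P; exists v.
    by exists (inl (SigSub inT)).
  have [[_ Zv _ _] _ _] := Zsat.
  have defZ : Z = [set vpath v].
    apply/seteqP; split=> [w Zw|_ -> //]; apply: contrapT => nw.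
    by apply: tr; exists w, (vpath v).
  have inE0 : v \in E0r_inf E by rewrite inE; apply/E0r_infP; rewrite -defZ.
  by exists (inr (SigSub inE0)).
have Sinj : injective S.
  have ntv Z v : frakT' E Z -> Z <> [set vpath v].
    move=> /frakT'P[_ [_ [w1 [w2 [Zw1 Zw2 nw]]]]] defZ.
    by rewrite defZ in Zw1 Zw2; apply: nw; rewrite Zw1 Zw2.
  move=> [Z|v] [Z'|v'] /= eS.
  - by congr inl; exact: val_inj.
  - by case: (ntv _ _ (set_mem (valP Z)) eS).
  - by case: (ntv _ _ (set_mem (valP Z')) (esym eS)).
  - congr inr; apply: val_inj.
    by have : [set vpath (\val v')] (vpath (\val v)) by [rewrite -eS]; case.
have /choice[f fE] : forall p, exists t : set_type (frakT E),
    \val (\val t) = trim (S p).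
  move=> p; have [v psat] := Ssat p; have [St _ _] := psat.
  have inF : trim (S p) \in @frakF_set E.
    by rewrite inE; exists v; exact: trim_frakF St.
  have inT : (SigSub inF : frakF E) \in frakT E.
    by rewrite inE; exact: trim_frakT psat _.
  by exists (SigSub inT).
exists f; rewrite -functions.setTT_bijective; split=> // [p q _ _ fpq|Z _].
  have [[v psat] [v' qsat]] := (Ssat p, Ssat q).
  have etrim : trim (S p) = trim (S q) by rewrite -!fE fpq.
  apply: Sinj; rewrite -(grow_trim psat) etrim.
  have [pt _ _] := psat; have [qt _ _] := qsat.
  have : S q (vpath v).
    apply: (trim_sub qt); rewrite -etrim; apply: trim_mem; last exact: not_ends_vpath.
    by have [] := pt.
  by move=> /(tree_src qt)[->]; exact: grow_trim.
have [v Zv] := set_mem (valP (\val Z)); have /frakF_atP[[_ Zvv _ _] _] := Zv.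
have [p Sp] := Ssurj _ _ (grow_saturated (set_mem (valP Z)) Zvv).
exists p => //; apply: val_inj; apply: val_inj; rewrite fE Sp.
exact: trim_grow.
Qed.
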